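(* Let $A, B$ be $n\times n$ positive semidefinite complex matrices and let $X$ be any $n\times n$ complex matrix. Let $s$ be a real number with $0\le s<\tfrac12$. Then for every unitarily invariant norm $|||\cdot|||$ on $n\times n$ complex matrices, $$\Big|\Big|\Big|\int_s^{1-s}A^vXB^{1-v}\,dv\Big|\Big|\Big|\le \frac{1-2s}{2}\,|||A^{1-s}XB^s+A^sXB^{1-s}|||.$$
   Context: A norm $|||\cdot|||$ on $n\times n$ complex matrices is unitarily invariant if $|||UXV|||=|||X|||$ for all matrices $X$ and all unitary $U,V$. Real powers of positive semidefinite matrices are defined by the spectral functional calculus, with the convention $A^0=I$. The integral is the entrywise (Riemann/Lebesgue) integral of a matrix-valued function. *)

(* Defs.v *)
From HB Require Import structures.
From mathcomp Require Import all_boot all_order all_algebra.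
From mathcomp Require Import spectral complex.
From mathcomp Require Import all_classical all_reals all_analysis.

Set Implicit Arguments.
Unset Strict Implicit.
Unset Printing Implicit Defensive.

Import Order.TTheory GRing.Theory Num.Theory.
Import numFieldNormedType.Exports.

Local Open Scope ring_scope.
Local Open Scope sesquilinear_scope.
Local Open Scope complex_scope.

(* In R[i], [0 <= z] means that z is real and nonnegative. *)
Definition psdmx (R : realType) (n : nat) (A : 'M[R[i]]_n) : Prop :=
  A \is hermsymmx /\ forall u : 'cV[R[i]]_n, 0 <= (u^t* *m A *m u) 0 0.

(* [spectralmx A] is the unitary P and [spectral_diag A] the row of eigenvalues
   d in the decomposition A = P^-1 *m diag_mx d *m P of a normal matrix A.  The
   eigenvalues of a Hermitian matrix are real, so [complex.Re] only changes
   their type; on a non-normal matrix the result is meaningless. *)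
Definition spectral_fun (R : realType) (n : nat) (f : R -> R)
    (A : 'M[R[i]]_n) : 'M[R[i]]_n :=
  invmx (spectralmx A)
  *m diag_mx (map_mx (fun z => (f (complex.Re z))%:C) (spectral_diag A))
  *m spectralmx A.

(* [0 `^ 0 = 1], so that [mxpowR A 0 = 1%:M] also when A is singular, and
   [0 `^ v = 0] for [v != 0]. *)
Definition mxpowR (R : realType) (n : nat) (A : 'M[R[i]]_n) (v : R) :
    'M[R[i]]_n :=
  spectral_fun (fun x => x `^ v) A.

Definition mx_integral (R : realType) (m n : nat) (D : set R)
    (F : R -> 'M[R[i]]_(m, n)) : 'M[R[i]]_(m, n) :=
  \matrix_(i < m, j < n)
    ((\int[lebesgue_measure]_(t in D) complex.Re (F t i j))
     +i* (\int[lebesgue_measure]_(t in D) complex.Im (F t i j))).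

Record unitarily_invariant_norm (R : realType) (n : nat)
    (N : 'M[R[i]]_n -> R) : Prop := UnitarilyInvariantNorm {
  uinorm_ge0 : forall X, 0 <= N X;
  uinorm_eq0 : forall X, N X = 0 -> X = 0;
  uinormZ : forall (c : R[i]) (X : 'M[R[i]]_n), N (c *: X) = complex.Re `|c| * N X;
  uinormD : forall X Y : 'M[R[i]]_n, N (X + Y) <= N X + N Y;
  uinormU : forall U V X : 'M[R[i]]_n, U \is unitarymx -> V \is unitarymx ->
    N (U *m X *m V) = N X
}.

(* Main.v *)
(* Diagonalising A and B turns the integrand into the Schur product of a matrix
   Y with the entries a_i^t b_j^(1-t), so the claim is a statement about Schur
   multipliers.  With x = ln a, y = ln b, the symmetrised integrand at t is
   2 cosh ((t - 1/2)(x_i - y_j)) applied to a fixed matrix W, and it suffices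
   that phi(t) = N (cosh (t (x_i - y_j)) o W) is nondecreasing on [0, +oo[
   (Heinz inequality); the triangle inequality along Riemann sums symmetric
   about 1/2 then gives the theorem.  The multiplier 1 / (1 + i t) is the mean
   of two unitary diagonal multipliers; letting the step of
   (1 + i e x_i)(1 - i e y_j) tend to 0 shows that 1 + i (x_i - y_j), hence
   1 + (x_i - y_j)^2, does not decrease the norm.  As
   cosh h = 1 + h^2 / 2 + O(h^3), the second differences of phi at step h are
   at least - O(h^3), and phi is even, so phi is nondecreasing along every
   grid once h -> 0.  Zero eigenvalues are discarded by a pinching. *)

Require Import Defs.
From HB Require Import structures.
From mathcomp Require Import all_boot all_order all_algebra.
From mathcomp Require Import spectral complex.
From mathcomp Require Import all_classical all_reals all_analysis.
From mathcomp Require Import measurable_realfun zify ring lra.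

Set Implicit Arguments.
Unset Strict Implicit.
Unset Printing Implicit Defensive.

Import Order.TTheory GRing.Theory Num.Theory.
Import numFieldNormedType.Exports.

Local Open Scope ring_scope.

(** * Elementary real estimates *)

Section RealEstimates.
Context {R : realType}.
Implicit Types (a b t : R) (f : nat -> R).

Definition cosh t : R := (expR t + expR (- t)) / 2.

Lemma coshN t : cosh (- t) = cosh t.
Proof. by rewrite /cosh opprK addrC. Qed.

Lemma cosh_ge0 t : 0 <= cosh t.
Proof. by rewrite divr_ge0 // addr_ge0 // expR_ge0. Qed.

Lemma coshDB a b : cosh (a + b) + cosh (a - b) = 2 * (cosh b * cosh a).
Proof. by rewrite /cosh !opprD opprK !expRD; field. Qed.

Lemma cosh_le_expR t b : `|t| <= b -> cosh t <= expR b.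
Proof.
move=> tb; have : expR t <= expR b by rewrite ler_expR (le_trans (ler_norm _)).
have : expR (- t) <= expR b.
  by rewrite ler_expR (le_trans (ler_norm _)) // normrN.
by rewrite /cosh; lra.
Qed.

(** With y = t / 2, cosh t - 1 = 2 sinh^2 y, so the remainder is 2 (sinh y - y)(sinh y + y); the
    crude bound y^2 on |sinh y - y| already gives order three. *)
Lemma cosh_taylor2 t : `|t| <= 1 -> `|cosh t - 1 - t ^+ 2 / 2| <= `|t| ^+ 3.
Proof.
move=> t1; pose y := t / 2; have y1 : `|y| <= 1 / 2.
  by rewrite /y normrM (ger0_norm (x := 2^-1)) //; lra.
have [E F] := (expR_ge1Dx y, expR_ge1Dx (- y)).
have EF : expR y * expR (- y) = 1 by rewrite -expRD subrr expR0.
have tE : t = y + y by rewrite /y; field.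
have cE : cosh t = 1 + (expR y - expR (- y)) ^+ 2 / 2.
  rewrite /cosh tE opprD !expRD.
  by move: EF; nra.
pose s := (expR y - expR (- y)) / 2.
have sy : `|s - y| <= y ^+ 2.
  rewrite /s; move: y1 E F EF; move: (expR y) (expR (- y)) => e f.
  rewrite !ler_norml => /andP[y1 y2] E F EF.
  (* As (1 - z)(1 + z + 2 z^2) = 1 + z^2 (1 - 2 z), the lower bound 1 - z on exp (- z) turns into an
     upper bound on exp z. *)
  have le_inv (z a b : R) : z <= 1 / 2 -> 1 - z <= b -> 0 <= a -> a * b = 1 ->
      a <= 1 + z + 2 * z ^+ 2.
    move=> z2 zb a0 ab; have z1 : 0 < 1 - z by lra.
    rewrite -(ler_pM2r z1); have : a * (1 - z) <= 1 by rewrite -[leRHS]ab ler_wpM2l.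
    have : 0 <= z ^+ 2 * (1 - 2 * z) by rewrite mulr_ge0 ?sqr_ge0 //; lra.
    lra.
  have e1 : e <= 1 + y + 2 * y ^+ 2 by apply: (le_inv y e f) => //; lra.
  have f1 : f <= 1 - y + 2 * (- y) ^+ 2.
    by apply: (le_inv (- y) f e); rewrite ?opprK 1?mulrC //; lra.
  by move: e1 f1; rewrite sqrrN; lra.
have -> : cosh t - 1 - t ^+ 2 / 2 = 2 * (s - y) * (s + y).
  by rewrite cE tE /s; field.
have sy' : `|s + y| <= 2 * `|y| + y ^+ 2.
  rewrite (_ : s + y = (s - y) + 2 * y); last by ring.
  rewrite (le_trans (ler_normD _ _)) // normrM (ger0_norm (x := 2)) //; lra.
rewrite !normrM (ger0_norm (x := 2)) //.
have -> : `|t| = 2 * `|y| by rewrite tE -mulr2n normrMn mulr_natl.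
move: sy sy' y1; rewrite -(real_normK (num_real y)).
move: `|y| (normr_ge0 y) `|s - y| (normr_ge0 (s - y)) `|s + y| => z z0 a a0 b.
move=> ha hb z1.
have : a * b <= z ^+ 2 * (2 * z + z ^+ 2).
  by rewrite (le_trans (ler_wpM2l a0 hb)) // ler_wpM2r ?addr_ge0 ?mulr_ge0 ?exprn_ge0 //.
have : 0 <= z ^+ 3 by rewrite exprn_ge0.
have : z ^+ 2 * (2 * z + z ^+ 2) = z ^+ 3 * (2 + z) by ring.
nra.
Qed.

Lemma ler_sum2_term (I J : finType) (F : I -> J -> R) i j :
  (forall i j, 0 <= F i j) -> F i j <= \sum_i \sum_j F i j.
Proof.
move=> F0; rewrite (bigD1 i) //= (bigD1 j) //= -addrA lerDl.
by rewrite addr_ge0 ?sumr_ge0 // => k _; apply: sumr_ge0.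
Qed.

(** Archimedean passage to the limit in m; the threshold [M] admits estimates that hold only on fine
    grids. *)
Lemma ler_addPinv a b (C M : R) :
  (forall m : nat, M <= m.+1%:R -> a <= b + C / m.+1%:R) -> a <= b.
Proof.
move=> h; rewrite leNgt; apply/negP => ba.
pose m := Num.bound (`|M| + `|C| / (a - b)).
have d0 : 0 < a - b by rewrite subr_gt0.
have [c0 c1] : 0 <= `|M| /\ 0 <= `|C| / (a - b).
  by rewrite normr_ge0 divr_ge0 // ltW.
have hm : `|M| + `|C| / (a - b) < m.+1%:R.
  rewrite (lt_trans (archi_boundP _)) ?addr_ge0 // ltr_nat //.
have := h m; have -> : M <= m.+1%:R.
  by rewrite (le_trans (ler_norm M)) //; move: hm; lra.
move=> /(_ isT); apply/negP; rewrite -ltNge -ltrBrDl ltr_pdivrMr //.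
have : `|C| / (a - b) < m.+1%:R by lra.
rewrite ltr_pdivrMr // mulrC; apply: le_lt_trans; exact: ler_norm.
Qed.

(** Almost convexity lets the bound on the decrease grow by 2e per step, so step k loses at most (2k
    + 1) e, and the odd numbers add up to k^2. *)
Lemma almost_convex_seq_le f (e : R) (m : nat) : 0 <= e -> f 0 <= f 1 + e ->
    (forall k, (k.+2 <= m)%N -> f k.+1 <= (f k.+2 + f k) / 2 + e) ->
  forall j k, (j <= k <= m)%N -> f j <= f k + k%:R ^+ 2 * e.
Proof.
move=> e0 f01 fc.
have incr k : (k < m)%N -> f k <= f k.+1 + (2 * k%:R + 1) * e.
  elim: k => [_|k IH km]; first by rewrite mulr0 add0r mul1r.
  by have := fc k km; have := IH (ltnW km); rewrite -[k.+1%:R]natr1; nra.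
move=> j; elim=> [|k IH] /andP[jk km].
  by move: jk; rewrite leqn0 => /eqP ->; rewrite expr0n /= mul0r addr0.
move: jk; rewrite leq_eqVlt => /predU1P[->|jk].
  by rewrite lerDl mulr_ge0 // exprn_ge0.
have := IH; rewrite -ltnS jk (ltnW km) => /(_ isT).
by have := incr k km; rewrite -[k.+1%:R]natr1; nra.
Qed.

End RealEstimates.

(** * Riemann sums of monotone functions *)

Section RiemannSums.
Context {R : realType}.
Implicit Types (f : R -> R) (s e d : R).
Notation mu := (@lebesgue_measure R).

Lemma nondecreasing_in_integrable f s e :
  {in `[s, e] &, {homo f : x y / x <= y}} ->
  mu.-integrable `[s, e]%classic (EFin \o f).
Proof.
move=> fm; have [se|es] := leP s e; last first.
  by rewrite set_itv_ge ?bnd_simp -?ltNge //; exact: integrable_set0.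
(* Clamping the argument gives a function that is nondecreasing on the whole line, hence measurable,
   and agrees with [f] on the interval. *)
pose g t := f (Num.max s (Num.min t e)).
have clamp t : Num.max s (Num.min t e) \in `[s, e].
  by rewrite in_itv /= le_max lexx /= ge_max se ge_min lexx orbT.
have mf : measurable_fun `[s, e]%classic f.
  apply: (eq_measurable_fun g).
    move=> t /set_mem /=; rewrite in_itv /= => /andP[st te].
    by rewrite /g (min_idPl te) (max_idPr st).
  apply: nondecreasing_measurable => // x y xy; apply: fm => //.
  by rewrite le_max2 // le_min2.
apply: measurable_bounded_integrable => //.
  by rewrite /= lebesgue_measure_itv /=; case: ifPn => // _; rewrite -EFinB ltry.
exists (`|f s| + `|f e|); split; first exact: num_real.
move=> M ltM t /=; rewrite in_itv /= => /andP[st te].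
have [sI eI tI] : [/\ s \in `[s, e], e \in `[s, e] & t \in `[s, e]].
  by rewrite !in_itv /= !lexx se st te.
have := fm _ _ sI tI st; have := fm _ _ tI eI te.
have := ler_norm (f e); have := ler_norm (- f s); rewrite normrN.
have := normr_ge0 (f e); have := normr_ge0 (f s).
rewrite ler_norml; lra.
Qed.

Lemma Rintegral_oc_cst s e c : s <= e ->
  \int[mu]_(x in `]s, e]%classic) (fun=> c) x = c * (e - s).
Proof.
move=> se; rewrite Rintegral_cst //= lebesgue_measure_itv /=.
rewrite lte_fin; case: ltP => [//|es]; have -> : e = s by lra.
by rewrite subrr.
Qed.

Section Nondecreasing.
Context (f : R -> R) (s d : R) (m : nat).
Context (d0 : 0 <= d)
  (fm : {in `[s, s + m%:R * d] &, {homo f : x y / x <= y}}).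

Let t k := s + k%:R * d.

Lemma riemann_bounds k : (k <= m)%N ->
  d * \sum_(i < k) f (t i) <= \int[mu]_(x in `[s, t k]%classic) f x
    <= d * \sum_(i < k) f (t i.+1).
Proof.
have tm i j : (i <= j)%N -> t i <= t j.
  by move=> ij; rewrite lerD2l ler_wpM2r // ler_nat.
have s0 : s = t 0 by rewrite /t mul0r addr0.
have tI i : (i <= m)%N -> t i \in `[s, t m].
  by move=> im; rewrite in_itv /= {1}s0 !tm.
elim: k => [_|k IH km].
  by rewrite !big_ord0 mulr0 /t mul0r addr0 set_itv1 Rintegral_set1 lexx.
have int_f : mu.-integrable `[s, t k.+1]%classic (EFin \o f).
  apply: nondecreasing_in_integrable => x y; rewrite !in_itv /=.
  move=> /andP[sx xk] /andP[sy yk]; apply: fm; rewrite in_itv /=.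
  - by rewrite sx (le_trans xk) // tm.
  - by rewrite sy (le_trans yk) // tm.
have split_int : \int[mu]_(x in `[s, t k.+1]%classic) f x =
    \int[mu]_(x in `[s, t k]%classic) f x +
    \int[mu]_(x in `]t k, t k.+1]%classic) f x.
  rewrite -(@Rintegral_itvB _ f (BLeft s) (BRight (t k.+1)) (t k)) //.
  - by rewrite addrC subrK.
  - by rewrite bnd_simp {1}s0 tm.
  - by rewrite bnd_simp tm.
have int_p : mu.-integrable `]t k, t k.+1]%classic (EFin \o f).
  apply: integrableS int_f => //; apply: subset_itvr.
  by rewrite bnd_simp {1}s0 tm.
have int_c c : mu.-integrable `]t k, t k.+1]%classic (EFin \o (fun=> c)).
  apply: measurable_bounded_integrable => //; last exact: bounded_cst.
  rewrite /= lebesgue_measure_itv /=.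
  by case: ifPn => // _; rewrite -EFinB ltry.
have dE : t k.+1 - t k = d by rewrite /t -[k.+1%:R]natr1; ring.
have lo : f (t k) * d <= \int[mu]_(x in `]t k, t k.+1]%classic) f x.
  rewrite -{1}dE -Rintegral_oc_cst ?tm //; apply: le_Rintegral => // x /=.
  rewrite in_itv /= => /andP[kx xk]; apply: fm; last exact: ltW.
    exact/tI/ltnW.
  by rewrite in_itv /= (le_trans xk) ?tm // andbT (le_trans _ (ltW kx)) // {1}s0 tm.
have hi : \int[mu]_(x in `]t k, t k.+1]%classic) f x <= f (t k.+1) * d.
  rewrite -dE -Rintegral_oc_cst ?tm //; apply: le_Rintegral => // x /=.
  rewrite in_itv /= => /andP[kx xk]; apply: fm => //; last exact: tI.
  by rewrite in_itv /= (le_trans xk) ?tm // andbT (le_trans _ (ltW kx)) // {1}s0 tm.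
have /andP[IH1 IH2] := IH (ltnW km).
rewrite split_int !big_ord_recr /= !mulrDr [d * f _]mulrC [d * f (t k.+1)]mulrC.
by rewrite !lerD.
Qed.

(* The nodes enter through the pairs t i, t (m - i), symmetric about the
   midpoint of the interval. *)
Lemma riemann_symmetric_sum :
  `|\int[mu]_(x in `[s, t m]%classic) f x
      - d / 2 * \sum_(i < m) (f (t i) + f (t (m - i)%N))|
    <= d * `|f (t m) - f s|.
Proof.
have /andP[lo hi] := riemann_bounds (leqnn m).
have rev : \sum_(i < m) f (t (m - i)%N) = \sum_(i < m) f (t i.+1).
  by rewrite (reindex_inj rev_ord_inj); apply: eq_bigr => i _; rewrite subKn.
(* The left and right sums differ by this telescoped increment, and the symmetric sum is their
   mean. *)
have tele : \sum_(i < m) f (t i.+1) = \sum_(i < m) f (t i) + (f (t m) - f s).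
  have := telescope_sumr (fun i => f (t i)) (leq0n m).
  have -> : t 0 = s by rewrite /t mul0r addr0.
  rewrite big_mkord sumrB => <-.
  by rewrite addrC subrK.
rewrite big_split /= rev; move: lo hi; rewrite tele.
set S := \sum_(i < m) _; set I := Rintegral _ _ _ => lo hi.
have := ler_wpM2l d0 (ler_norm (f (t m) - f s)).
by rewrite ler_norml; lra.
Qed.

End Nondecreasing.
End RiemannSums.

(** * The kernel a^t b^(1-t) *)

Section PowerKernel.
Context {R : realType}.
Implicit Types a b s t d : R.
Notation mu := (@lebesgue_measure R).

Lemma powR_kernel_exp a b t : a != 0 -> b != 0 ->
  a `^ t * b `^ (1 - t) = expR (t * ln a + (1 - t) * ln b).
Proof. by move=> a0 b0; rewrite /powR (negPf a0) (negPf b0) expRD. Qed.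

(** The exponent splits into the mean of the logarithms and (t - 1/2) times their difference; only
    the latter depends on t. *)
Lemma powR_kernel_cosh a b t : a != 0 -> b != 0 ->
  a `^ t * b `^ (1 - t) + a `^ (1 - t) * b `^ t =
  2 * (cosh ((t - 2^-1) * (ln a - ln b)) * expR ((ln a + ln b) / 2)).
Proof.
move=> a0 b0; have := powR_kernel_exp (1 - t) a0 b0; rewrite subKr => ->.
set u := (t - _) * _; set w := (_ + _) / 2.
rewrite powR_kernel_exp // (_ : 2 * _ = expR (u + w) + expR (- u + w)).
  by congr (expR _ + expR _); rewrite /u /w; field.
by rewrite /cosh !expRD; field.
Qed.

(** The strict bounds keep both exponents nonzero, away from the convention that 0 to the power 0 is
    1. *)
Lemma powR_kernel0 a b t : (a == 0) || (b == 0) -> 0 < t < 1 ->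
  a `^ t * b `^ (1 - t) + a `^ (1 - t) * b `^ t = 0.
Proof.
move=> ab /andP[t0 t1]; have [t0' t1'] : t != 0 /\ 1 - t != 0.
  by rewrite lt0r_neq0 // lt0r_neq0 // subr_gt0.
by case/orP: ab => /eqP ->; rewrite !powR0 // ?mul0r ?mulr0 addr0.
Qed.

(** For nonzero bases the exponent is affine in t. A zero base leaves at most a jump at an end of
    [0, 1], so monotonicity survives where continuity can fail. *)
Lemma powR_kernel_monotone a b (f := fun t => a `^ t * b `^ (1 - t)) :
  {in `[0, 1] &, {homo f : x y / x <= y}} \/
  {in `[0, 1] &, {homo (fun t => - f t) : x y / x <= y}}.
Proof.
have [a0|a0] := eqVneq a 0.
  right=> x y; rewrite !in_itv /= => /andP[x0 _] _ xy; rewrite lerN2.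
  have [y0|y0] := eqVneq y 0; last by rewrite /f a0 powR0 // mul0r mulr_ge0 ?powR_ge0.
  by have -> : x = y by apply/le_anti; rewrite xy y0 x0.
have [b0|b0] := eqVneq b 0.
  left=> x y; rewrite !in_itv /= => _ /andP[_ y1] xy.
  have [x1|x1] := eqVneq (1 - x) 0.
    by have -> : x = y by apply/le_anti; rewrite xy /=; move/eqP: x1; lra.
  by rewrite /f b0 (powR0 x1) mulr0 mulr_ge0 ?powR_ge0.
have [ab|ab] := leP (ln b) (ln a); [left|right] => x y _ _ xy.
  by rewrite /f !powR_kernel_exp // ler_expR; nra.
by rewrite lerN2 /f !powR_kernel_exp // ler_expR; nra.
Qed.

Lemma integrable_opp (D : set R) (f : R -> R) : measurable D ->
  mu.-integrable D (EFin \o (fun t => - f t)) -> mu.-integrable D (EFin \o f).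
Proof.
move=> mD /integrableN; apply: eq_integrable => // t _ /=.
by rewrite opprK.
Qed.

Lemma powR_kernel_integrable a b s t : 0 <= s -> t <= 1 ->
  mu.-integrable `[s, t]%classic (EFin \o (fun v => a `^ v * b `^ (1 - v))).
Proof.
move=> s0 t1; have sub : {subset `[s, t] <= `[0, 1]}.
  move=> v; rewrite !in_itv /= => /andP[sv vt].
  by rewrite (le_trans s0 sv) (le_trans vt t1).
case: (powR_kernel_monotone a b) => mono; last apply: integrable_opp => //.
  by apply: nondecreasing_in_integrable => x y /sub ? /sub ?; exact: mono.
by apply: nondecreasing_in_integrable => x y /sub ? /sub ?; exact: mono.
Qed.

Lemma powR_kernel_riemann a b s d (m : nat) (f := fun t => a `^ t * b `^ (1 - t)) :
    0 <= s -> 0 <= d -> s + m%:R * d <= 1 ->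
  `|\int[mu]_(v in `[s, s + m%:R * d]%classic) f v
     - d / 2 * \sum_(i < m) (f (s + i%:R * d) + f (s + (m - i)%N%:R * d))|
    <= d * `|f (s + m%:R * d) - f s|.
Proof.
move=> s0 d0 t1; have sub : {subset `[s, s + m%:R * d] <= `[0, 1]}.
  move=> v; rewrite !in_itv /= => /andP[sv vt].
  by rewrite (le_trans s0 sv) (le_trans vt t1).
case: (powR_kernel_monotone a b) => mono.
  by apply: riemann_symmetric_sum => // x y /sub ? /sub ?; exact: mono.
have fm : {in `[s, s + m%:R * d] &, {homo (fun t => - f t) : x y / x <= y}}.
  by move=> x y /sub ? /sub ?; exact: mono.
have := riemann_symmetric_sum d0 fm.
have -> : \int[mu]_(v in `[s, s + m%:R * d]%classic) (- f v) =
    - \int[mu]_(v in `[s, s + m%:R * d]%classic) f v.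
  under eq_Rintegral do rewrite -mulN1r.
  by rewrite RintegralZl ?mulN1r //; exact: powR_kernel_integrable.
under [\sum_(_ < _) _]eq_bigr do rewrite -opprD.
by rewrite sumrN mulrN -opprD normrN -opprD normrN.
Qed.

End PowerKernel.

(** * Schur multipliers under unitarily invariant norms *)

Lemma diag_mx_unitary (C : numClosedFieldType) n (d : 'rV[C]_n) :
  (forall i, `|d 0 i| = 1) -> diag_mx d \is unitarymx.
Proof.
move=> d1; apply/unitarymxP/matrixP => i j; rewrite mul_diag_mx !mxE.
have [->|_] := eqVneq i j; first by rewrite !mulr1n -normCK d1 expr1n.
by rewrite mulr0n conjC0 mulr0.
Qed.

Section UnitarilyInvariantNorm.
Local Open Scope complex_scope.
Context {R : realType} {n : nat} {N : 'M[R[i]]_n -> R}.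
Context (hN : unitarily_invariant_norm N).
Implicit Types (W : 'M[R[i]]_n) (x y : 'I_n -> R).

Let schur (k : 'I_n -> 'I_n -> R[i]) W := \matrix_(i, j) (k i j * W i j).

Lemma uinorm_scale (c : R) W : 0 <= c -> N (c%:C *: W) = c * N W.
Proof. by move=> c0; rewrite (uinormZ hN) ger0_norm ?ler0c. Qed.

Lemma uinorm0 : N 0 = 0.
Proof. by rewrite -(scale0r 0) (uinorm_scale 0 (lexx 0)) mul0r. Qed.

Lemma uinorm_sum (I : Type) (r : seq I) (P : pred I) (F : I -> 'M[R[i]]_n) :
  N (\sum_(k <- r | P k) F k) <= \sum_(k <- r | P k) N (F k).
Proof.
elim/big_rec2: _ => [|k a M _ IH]; first by rewrite uinorm0.
by rewrite (le_trans (uinormD hN _ _)) // lerD2l.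
Qed.

Lemma uinorm_phase_row (u : 'I_n -> R[i]) W :
  (forall i, `|u i| = 1) -> N (schur (fun i _ => u i) W) = N W.
Proof.
move=> u1; rewrite -[RHS](uinormU hN _ (U := diag_mx (\row_i u i)) (V := 1%:M)).
- by congr N; apply/matrixP => i j; rewrite mulmx1 mul_diag_mx !mxE.
- by apply: diag_mx_unitary => i; rewrite mxE.
- by apply/unitarymxP; rewrite trmx1 map_mx1 mulmx1.
Qed.

Lemma uinorm_phase_col (u : 'I_n -> R[i]) W :
  (forall i, `|u i| = 1) -> N (schur (fun _ j => u j) W) = N W.
Proof.
move=> u1; rewrite -[RHS](uinormU hN _ (V := diag_mx (\row_i u i)) (U := 1%:M)).
- congr N; apply/matrixP => i j; rewrite mul1mx.
  by rewrite mul_mx_diag !mxE mulrC.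
- by apply/unitarymxP; rewrite trmx1 map_mx1 mulmx1.
- by apply: diag_mx_unitary => i; rewrite mxE.
Qed.

Lemma uinorm_half (V W : 'M[R[i]]_n) (M : R) :
  N V <= M -> N W <= M -> N (2^-1%:C *: (V + W)) <= M.
Proof.
move=> hV hW; rewrite uinorm_scale ?invr_ge0 //.
rewrite mulrC ler_pdivrMr // (le_trans (uinormD hN _ _)) //; lra.
Qed.

(* A diagonal matrix with entries (1 + u) / 2, |u| = 1, is the mean of two
   unitary matrices, hence a contraction for every unitarily invariant norm. *)
Lemma uinorm_contraction (p q u w : 'I_n -> R[i]) W :
    (forall i, `|u i| = 1) -> (forall i, `|w i| = 1) ->
    (forall i, p i = 2^-1%:C * (1 + u i)) ->
    (forall i, q i = 2^-1%:C * (1 + w i)) ->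
  N (schur (fun i j => p i * q j) W) <= N W.
Proof.
move=> u1 w1 pE qE.
have col V : N (schur (fun _ j => q j) V) <= N V.
  have -> : schur (fun _ j => q j) V =
      2^-1%:C *: (V + schur (fun _ j => w j) V).
    by apply/matrixP => i j; rewrite !mxE qE; ring.
  by apply: uinorm_half; rewrite // uinorm_phase_col.
have row V : N (schur (fun i _ => p i) V) <= N V.
  have -> : schur (fun i _ => p i) V =
      2^-1%:C *: (V + schur (fun i _ => u i) V).
    by apply/matrixP => i j; rewrite !mxE pE; ring.
  by apply: uinorm_half; rewrite // uinorm_phase_row.
have -> : schur (fun i j => p i * q j) W =
    schur (fun i _ => p i) (schur (fun _ j => q j) W).
  by apply/matrixP => i j; rewrite !mxE mulrA.
exact: le_trans (row _) (col _).
Qed.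

(** An indicator is (1 + u) / 2 with a sign u, so [uinorm_contraction] applies. *)
Lemma uinorm_pinch (p q : pred 'I_n) W :
  N (schur (fun i j => (p i && q j)%:R) W) <= N W.
Proof.
pose u (p : pred 'I_n) i : R[i] := if p i then 1 else -1.
have u1 p' i : `|u p' i| = 1 by rewrite /u; case: ifP; rewrite ?normrN normr1.
have uE (p' : pred 'I_n) i : (p' i)%:R = 2^-1%:C * (1 + u p' i).
  rewrite /u; case: ifP => _; last by rewrite subrr mulr0.
  by rewrite fmorphV /= rmorph_nat mulVf // pnatr_eq0.
rewrite (le_trans _ (uinorm_contraction W (u1 p) (u1 q) (uE p) (uE q))) //.
by under [X in _ <= N X]eq_mx do rewrite -natrM mulnb.
Qed.

(* Cayley transform: 1 / (1 + i t) = (1 + u) / 2 with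
   u = (1 - i t) / (1 + i t) of modulus 1. *)
Lemma uinorm_expansion x y W :
  N W <= N (schur (fun i j => (1 +i* x i) * (1 +i* y j)) W).
Proof.
pose u (t : R) := (1 -i* t) / (1 +i* t).
have nz (t : R) : 1 +i* t != 0 by rewrite eq_complex /= oner_eq0.
have u1 t : `|u t| = 1.
  have e : `|1 -i* t| = `|1 +i* t| by rewrite !normc_def /= sqrrN.
  by rewrite normf_div e divff // normr_eq0.
have uE t : (1 +i* t)^-1 = 2^-1%:C * (1 + u t).
  apply: (mulfI (nz t)); rewrite divff // /u mulrCA mulrDr mulr1 mulrCA.
  rewrite divff // mulr1.
  by apply/eqP; rewrite eq_complex /=; apply/andP; split; apply/eqP; field.
(* The contraction acts on the expanded matrix [V], from which the reciprocal multipliers recover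
   [W]. *)
set V := schur _ W.
have -> : W = schur (fun i j => (1 +i* x i)^-1 * (1 +i* y j)^-1) V.
  by apply/matrixP => i j; rewrite !mxE -invfM mulKf // mulf_neq0.
apply: (uinorm_contraction V (u := u \o x) (w := u \o y)) => i /=;
  by [exact: uE | exact: u1].
Qed.

(* The numbers i (x_i - y_j) generate a group of isometries, so the resolvent
   is a contraction: (1 + i e x)(1 - i e y) = 1 + i e (x - y) + e^2 x y, and
   convexity of the norm along 1 + i e (x - y) gives the claim as e -> 0. *)
Lemma uinorm_resolvent x y W :
  N W <= N (schur (fun i j => 1 +i* (x i - y j)) W).
Proof.
set V := schur _ W; pose Z := schur (fun i j => (x i * y j)%:C) W.
apply: (@ler_addPinv _ _ _ (N Z) 0) => m _.
pose e : R := m.+1%:R^-1; have e0 : 0 < e by rewrite invr_gt0.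
have e1 : 0 <= 1 - e by rewrite subr_ge0 invf_le1 // ler1n.
have := uinorm_expansion (fun i => e * x i) (fun j => - (e * y j)) W.
have -> : schur (fun i j => (1 +i* (e * x i)) * (1 -i* (e * y j))) W =
    (1 - e)%:C *: W + (e%:C *: V + (e ^+ 2)%:C *: Z).
  apply/matrixP => i j; rewrite !mxE !mulrA -!mulrDl; congr (_ * _).
  by apply/eqP; rewrite eq_complex /=; apply/andP; split; apply/eqP; ring.
move=> le1; have := le_trans le1 (uinormD hN _ _).
have := uinormD hN (e%:C *: V) ((e ^+ 2)%:C *: Z).
have e0' := ltW e0; rewrite !uinorm_scale ?exprn_ge0 // => le2 le3.
(* Moving (1 - e) N W to the left leaves a common factor e, and the quadratic term survives as an
   error of order e. *)
have : e * N W <= e * (N V + N Z * e) by lra.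
by rewrite ler_pM2l.
Qed.

(** 1 + h^2 = (1 + i h)(1 - i h), so the resolvent bound is used twice, with opposite signs. *)
Lemma uinorm_le_1Dsqr x y W :
  N W <= N (schur (fun i j => (1 + (x i - y j) ^+ 2)%:C) W).
Proof.
rewrite (le_trans (uinorm_resolvent x y W)) //.
rewrite (le_trans (uinorm_resolvent (fun i => - x i) (fun j => - y j) _)) //.
rewrite le_eqVlt; apply/orP; left; apply/eqP; congr N; apply/matrixP => i j.
rewrite !mxE !mulrA; congr (_ * _).
by apply/eqP; rewrite eq_complex /=; apply/andP; split; apply/eqP; ring.
Qed.

(** Expansion over the matrix units, whose norms sum to [K]; it converts entrywise errors into norm
    errors. *)
Lemma uinorm_entry_bound : exists2 K : R, 0 <= K &
  forall (Y : 'M[R[i]]_n) (e : R), (forall i j, `|Y i j| <= e%:C) -> N Y <= K * e.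
Proof.
exists (\sum_i \sum_j N (delta_mx i j)).
  by apply: sumr_ge0 => i _; apply: sumr_ge0 => j _; exact: (uinorm_ge0 hN).
move=> Y e Ye; rewrite [Y in N Y]matrix_sum_delta.
rewrite (le_trans (uinorm_sum _ _ _)) // mulr_suml ler_sum // => i _.
rewrite (le_trans (uinorm_sum _ _ _)) // mulr_suml ler_sum // => j _.
rewrite (uinormZ hN) mulrC ler_wpM2l ?(uinorm_ge0 hN) //.
by have := Ye i j; rewrite lecE => /andP[].
Qed.

(** * Monotonicity along the cosh multipliers and the Heinz inequality *)

Let phi x y W (t : R) := N (schur (fun i j => (cosh (t * (x i - y j)))%:C) W).

Lemma phiN x y W t : phi x y W (- t) = phi x y W t.
Proof. by congr N; apply/matrixP => i j; rewrite !mxE mulNr coshN. Qed.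

(** With z = x_i - y_j, the mean of the matrices at t + h and t - h is the multiplier cosh (h z)
    applied to the matrix at t. Its Taylor polynomial 1 + (h z)^2 / 2 does not decrease the norm,
    and the remainder is cubic in h, uniformly for |t| <= T. *)
Lemma phi_local_convexity x y W (T : R) : exists2 C : R, 0 <= C &
  forall t h, `|t| <= T -> (forall i j, `|h * (x i - y j)| <= 1) ->
    phi x y W t <= (phi x y W (t + h) + phi x y W (t - h)) / 2 + C * `|h| ^+ 3.
Proof.
have [K K0 KP] := uinorm_entry_bound.
pose D := \sum_i \sum_j `|x i - y j|; pose w := \sum_i \sum_j complex.Re `|W i j|.
have nn (z : R[i]) : 0 <= complex.Re `|z| by rewrite normc_def /= sqrtr_ge0.
have D0 : 0 <= D by apply: sumr_ge0 => i _; apply: sumr_ge0.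
have w0 : 0 <= w.
  by apply: sumr_ge0 => i _; apply: sumr_ge0 => j _.
have DP i j : `|x i - y j| <= D.
  exact: (ler_sum2_term (F := fun i j => `|x i - y j|)).
have wP i j : `|W i j| <= w%:C.
  rewrite -[`|W i j|]RRe_real ?normr_real // lecR.
  exact: (ler_sum2_term (F := fun i j => complex.Re `|W i j|)).
(* The factors account in turn for the passage from entries to norm, |x_i - y_j|^3, cosh (t (x_i -
   y_j)) and the entries of [W]. *)
exists (K * (D ^+ 3 * (expR (T * D) * w))).
  by rewrite !mulr_ge0 // ?exprn_ge0 // expR_ge0.
move=> t h tT hd.
set V := schur (fun i j => (cosh (t * (x i - y j)))%:C) W.
(* Scaling by 1 / sqrt 2 turns 1 + (h z)^2 into the Taylor polynomial 1 + (h z)^2 / 2. *)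
pose c : R := (Num.sqrt 2)^-1.
have c2 : c ^+ 2 = 2^-1 by rewrite exprVn sqr_sqrtr.
have := uinorm_le_1Dsqr (fun i => c * h * x i) (fun j => c * h * y j) V.
pose E := schur (fun i j =>
  (1 + (h * (x i - y j)) ^+ 2 / 2 - cosh (h * (x i - y j)))%:C) V.
pose M s := schur (fun i j => (cosh (s * (x i - y j)))%:C) W.
set L := schur _ V.
have -> : L = 2^-1%:C *: (M (t + h) + M (t - h)) + E.
  apply/matrixP => i j; rewrite !mxE -mulrDl !mulrA -mulrDl; congr (_ * _).
  rewrite -!rmorphD -!rmorphM -rmorphD /=; congr (_%:C).
  rewrite (mulrDl t) (mulrBl _ t) coshDB mulKf // -!mulrBr !exprMn c2.
  by field.
have NE : N E <= K * (D ^+ 3 * (expR (T * D) * w)) * `|h| ^+ 3.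
  have -> : K * (D ^+ 3 * (expR (T * D) * w)) * `|h| ^+ 3 =
    K * ((`|h| * D) ^+ 3 * (expR (T * D) * w)) by rewrite exprMn; ring.
  apply: KP => i j; rewrite !mxE !normrM.
  have nR (r : R) : `|r%:C| = `|r|%:C.
    by rewrite normc_def /= expr0n addr0 sqrtr_sqr.
  rewrite !nR [leRHS]rmorphM [X in _ <= _ * X]rmorphM /=; apply: ler_pM => //.
  - by rewrite ler0c.
  - by rewrite mulr_ge0 // ler0c.
  - rewrite lecR distrC -[leLHS]/(`|_|) opprD addrA.
    rewrite (le_trans (cosh_taylor2 (hd i j))) // lerXn2r ?nnegrE ?mulr_ge0 //.
    by rewrite normrM ler_wpM2l.
  - apply: ler_pM => //; first by rewrite ler0c.
    rewrite lecR ger0_norm ?cosh_ge0 // cosh_le_expR // normrM.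
    by rewrite ler_pM.
move=> /le_trans -> //; rewrite (le_trans (uinormD hN _ _)) // lerD //.
rewrite uinorm_scale ?invr_ge0 // mulrC ler_wpM2r ?invr_ge0 //.
exact: (uinormD hN).
Qed.

(** Cutting [b] into r steps of size h, the errors accumulate to (k r)^2 C |h|^3 = k^2 C |b|^3 / r,
    which vanishes as r grows. *)
Lemma phi_le x y W (b : R) (j k : nat) :
  (j <= k)%N -> phi x y W (j%:R * b) <= phi x y W (k%:R * b).
Proof.
move=> jk.
have [C C0 CP] := phi_local_convexity x y W (k%:R * `|b|).
(* From r >= [D] on, |h (x_i - y_j)| <= 1, as local convexity requires. *)
pose D := \sum_i \sum_j `|b * (x i - y j)|.
apply: (@ler_addPinv _ _ _ (k%:R ^+ 2 * (C * `|b| ^+ 3)) D) => m.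
set r := m.+1; move=> rD.
have r0 : 0 < r%:R :> R by rewrite ltr0n.
have rV : `|r%:R^-1| = r%:R^-1 :> R by rewrite ger0_norm ?invr_ge0 // ltW.
pose h := b / r%:R; pose f i := phi x y W (i%:R * h).
have hd i i' : `|h * (x i - y i')| <= 1.
  rewrite /h mulrAC normrM rV ler_pdivrMr // mul1r (le_trans _ rD) //.
  exact: (ler_sum2_term (F := fun i j => `|b * (x i - y j)|)).
have fE i : phi x y W (i%:R * b) = f (i * r)%N.
  by rewrite /f natrM /h mulrACA mulfV ?mulr1 // lt0r_neq0.
have e0 : 0 <= C * `|h| ^+ 3 by rewrite mulr_ge0 ?exprn_ge0.
(* Local convexity at 0, where evenness makes both neighbours equal. *)
have f01 : f 0 <= f 1 + C * `|h| ^+ 3.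
  have := CP 0 h; rewrite normr0 mulr_ge0 // => /(_ isT hd).
  rewrite add0r sub0r phiN.
  by rewrite /f mul0r mul1r; lra.
have fc i : (i.+2 <= k * r)%N ->
    f i.+1 <= (f i.+2 + f i) / 2 + C * `|h| ^+ 3.
  move=> ik; have := CP (i.+1%:R * h) h.
  have -> : `|i.+1%:R * h| <= k%:R * `|b|.
    rewrite !normrM normr_nat rV mulrA mulrAC ler_wpM2r // ler_pdivrMr // -natrM ler_nat.
    exact: ltnW.
  move=> /(_ isT hd).
  have -> : i.+1%:R * h + h = i.+2%:R * h by rewrite -[i.+2%:R]natr1; ring.
  by have -> : i.+1%:R * h - h = i%:R * h by rewrite -[i.+1%:R]natr1; ring.
rewrite !fE (le_trans (almost_convex_seq_le e0 f01 fc (j := j * r) (k := k * r) _)) //.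
  by rewrite leq_mul2r jk orbT leqnn.
rewrite lerD2l /h normrM rV natrM.
rewrite le_eqVlt; apply/orP; left; apply/eqP; field.
by rewrite lt0r_neq0.
Qed.

(** A node is no farther from 1/2 than [s], and by [phi_le] the norm grows with that distance. *)
Lemma heinz_schur (a b : 'I_n -> R) W (s : R) (m k : nat)
    (G := fun t i j => a i `^ t * b j `^ (1 - t) + a i `^ (1 - t) * b j `^ t)
    (t := s + k%:R * ((1 - 2 * s) / m%:R)) :
    0 <= s -> s < 1 / 2 -> (k <= m)%N -> (0 < m)%N ->
  N (schur (fun i j => (G t i j)%:C) W) <= N (schur (fun i j => (G s i j)%:C) W).
Proof.
move=> s0 s1 km m0; have mp : 0 < m%:R :> R by rewrite ltr0n.
(* The end nodes are settled apart: for s = 0 they are 0 and 1, where entries with a zero base need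
   not vanish. *)
have [k0|kp] := posnP k; first by rewrite /t k0 mul0r addr0.
move: km; rewrite leq_eqVlt => /predU1P[kE|km].
  rewrite le_eqVlt; apply/orP; left; apply/eqP; congr N; apply/matrixP => i j.
  have -> : t = 1 - s by rewrite /t kE; field; rewrite lt0r_neq0.
  by rewrite !mxE /G subKr addrC.
(* Half the node spacing, so that s - 1/2 = - m c and t - 1/2 = (2k - m) c are multiples of one
   step. *)
pose c := (1 - 2 * s) / (2 * m%:R).
have c0 : 0 < c by rewrite divr_gt0 //; lra.
have tc : t = s + 2 * k%:R * c by rewrite /t /c; field; rewrite lt0r_neq0.
have sc : s = 2^-1 - m%:R * c by rewrite /c; field; rewrite lt0r_neq0.
have t01 : 0 < t < 1.
  have k1 : 0 < k%:R * c by rewrite mulr_gt0 // ltr0n.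
  have k2 : k%:R * c < m%:R * c by rewrite ltr_pM2r // ltr_nat.
  by apply/andP; split; rewrite tc; lra.
pose x i := ln (a i); pose y j := ln (b j).
pose P i j := ((a i != 0) && (b j != 0))%:R : R[i].
pose W' := schur (fun i j => P i j * (expR ((x i + y j) / 2))%:C) W.
have GP u i j : P i j * (G u i j)%:C =
    (2 * cosh ((u - 2^-1) * (x i - y j)))%:C *
      (P i j * (expR ((x i + y j) / 2))%:C).
  rewrite /P; have [/andP[a0 b0]|_] := boolP ((a i != 0) && (b j != 0)).
    by rewrite !mul1r /G powR_kernel_cosh // mulrA rmorphM.
  by rewrite !(mul0r, mulr0).
have GE u : schur P (schur (fun i j => (G u i j)%:C) W) =
    2%:C *: schur (fun i j => (cosh ((u - 2^-1) * (x i - y j)))%:C) W'.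
  by apply/matrixP => i j; rewrite !mxE mulrA GP rmorphM !mulrA.
have phiE u : N (schur P (schur (fun i j => (G u i j)%:C) W)) =
    2 * phi x y W' (u - 2^-1) by rewrite GE uinorm_scale.
(* Pinching to nonzero bases does not increase the side at s, and leaves the side at t unchanged
   because 0 < t < 1. *)
rewrite (le_trans _ (uinorm_pinch (fun i => a i != 0) (fun j => b j != 0) _)) //.
rewrite -/(schur P _) phiE.
have -> : schur (fun i j => (G t i j)%:C) W =
    schur P (schur (fun i j => (G t i j)%:C) W).
  apply/matrixP => i j; rewrite !mxE /P.
  have [_|ab] := boolP ((a i != 0) && (b j != 0)); first by rewrite mul1r.
  by rewrite /G powR_kernel0 ?mul0r ?mulr0 //; move: ab; rewrite negb_and !negbK.
rewrite phiE ler_pM2l //.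
have -> : s - 2^-1 = - (m%:R * c) by rewrite {1}sc; ring.
rewrite phiN.
(* Natural subtraction truncates, so the two sides of 1/2 are separated; evenness reflects the left
   one. *)
have [mk|mk] := leqP m (2 * k).
  have -> : t - 2^-1 = (2 * k - m)%N%:R * c.
    by rewrite natrB // natrM tc {1}sc; ring.
  apply: phi_le; rewrite leq_subLR; lia.
have -> : t - 2^-1 = - ((m - 2 * k)%N%:R * c).
  by rewrite natrB ?natrM ?(ltnW mk) // tc {1}sc; ring.
rewrite phiN.
by apply: phi_le; rewrite leq_subr.
Qed.

(** In the symmetric Riemann sum [Q] each of the m terms has norm at most [S] by [heinz_schur], and
    the weights d / 2 add up to (1 - 2s) / 2; the Riemann error is O(1 / m). *)
Lemma uinorm_powR_integral_le (a b : 'I_n -> R) W (s : R)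
    (k := fun i j t => a i `^ t * b j `^ (1 - t)) :
    0 <= s -> s < 1 / 2 ->
  N (schur (fun i j =>
       (\int[lebesgue_measure]_(t in `[s, 1 - s]%classic) k i j t)%:C) W)
  <= (1 - 2 * s) / 2 *
     N (schur (fun i j => (k i j s + a i `^ (1 - s) * b j `^ s)%:C) W).
Proof.
move=> s0 s1; set I := schur _ W; set S := N (schur _ W).
have [K K0 KP] := uinorm_entry_bound.
pose B := \sum_i \sum_j `|k i j (1 - s) - k i j s| * complex.Re `|W i j|.
apply: (@ler_addPinv _ _ _ (K * ((1 - 2 * s) * B)) 0) => m' _.
set m := m'.+1; have mp : 0 < m%:R :> R by rewrite ltr0n.
pose d := (1 - 2 * s) / m%:R; pose t (l : nat) := s + l%:R * d.
have d0 : 0 <= d by rewrite divr_ge0 ?ltW //; lra.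
have d20 : 0 <= d / 2 by move: d0; lra.
have tm : t m = 1 - s by rewrite /t /d; field; rewrite lt0r_neq0.
pose g i j l := k i j (t l) + k i j (t (m - l)%N).
pose Q := (d / 2)%:C *: \sum_(l < m) schur (fun i j => (g i j l)%:C) W.
have NQ : N Q <= (1 - 2 * s) / 2 * S.
  rewrite uinorm_scale //.
  have -> : (1 - 2 * s) / 2 * S = d / 2 * (m%:R * S).
    by rewrite /d; field; rewrite lt0r_neq0.
  rewrite ler_wpM2l // (le_trans (uinorm_sum _ _ _)) //.
  rewrite -[X in X%:R * _]card_ord -sum1_card natr_sum mulr_suml.
  apply: ler_sum => l _; rewrite mul1r.
  have lm := ltnW (ltn_ord l).
  have := heinz_schur a b W s0 s1 lm (ltn0Sn m').
  rewrite -/m -/d -/(t l); apply: le_trans; rewrite le_eqVlt; apply/orP; left.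
  apply/eqP; congr N; apply/matrixP => i j; rewrite !mxE /g /k.
  (* Reflecting the nodes about 1/2 makes each pair a symmetrised kernel. *)
  have -> : t (m - l)%N = 1 - t l.
    by rewrite -[1](subrK s) -tm /t natrB //; ring.
  by rewrite subKr.
have NE : N (I - Q) <= K * (d * B).
  apply: KP => i j; rewrite !mxE.
  have -> : \sum_(l < m) schur (fun i j => (g i j l)%:C) W =
      schur (fun i j => (\sum_(l < m) g i j l)%:C) W.
    apply/matrixP => i' j'; rewrite summxE mxE rmorph_sum mulr_suml.
    by apply: eq_bigr => l _; rewrite mxE.
  rewrite mxE mulrA -rmorphM -mulrBl -rmorphB normrM.
  have -> : `|W i j| = (complex.Re `|W i j|)%:C.
    by rewrite RRe_real // normr_real.
  have nR (r : R) : `|r%:C| = `|r|%:C.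
    by rewrite normc_def /= expr0n addr0 sqrtr_sqr.
  rewrite nR -rmorphM lecR.
  have := powR_kernel_riemann (a i) (b j) (s := s) (d := d) (m := m) s0 d0.
  rewrite -/(t m) tm => /(_ _)/le_trans H.
  have Re0 i' j' : 0 <= complex.Re `|W i' j'|.
    by rewrite normc_def /= sqrtr_ge0.
  rewrite (@le_trans _ _ (d * (`|k i j (1 - s) - k i j s| * complex.Re `|W i j|))) //.
    by rewrite mulrA ler_wpM2r // H //; lra.
  rewrite ler_wpM2l //.
  apply: (ler_sum2_term (F := fun i j =>
    `|k i j (1 - s) - k i j s| * complex.Re `|W i j|)) => i' j'.
  by rewrite mulr_ge0.
rewrite -[I in N I](subrK Q) addrC (le_trans (uinormD hN _ _)) // lerD //.
rewrite (le_trans NE) // le_eqVlt; apply/orP; left; apply/eqP.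
by rewrite /d; field; rewrite lt0r_neq0.
Qed.

End UnitarilyInvariantNorm.

(** * Integrals of matrix-valued functions *)

Section ComplexCombinations.
Local Open Scope complex_scope.
Context {d : measure_display} {T : measurableType d} {R : realType}.
Context (mu : {measure set T -> \bar R}).

Lemma Rintegral_sum (I : Type) (r : seq I) (D : set T) (g : I -> T -> R) :
    measurable D -> (forall i, mu.-integrable D (EFin \o g i)) ->
  mu.-integrable D (EFin \o (fun t => \sum_(i <- r) g i t)) /\
  \int[mu]_(t in D) (\sum_(i <- r) g i t) =
    \sum_(i <- r) \int[mu]_(t in D) g i t.
Proof.
move=> mD ig; elim: r => [|i r [IHi IHe]].
  split; last first.
    rewrite big_nil; under eq_Rintegral do rewrite big_nil.
    by rewrite Rintegral_cst ?mul0r.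
  apply: (eq_integrable mD _ _ _ (integrable0 mu D)) => t _ /=.
  by rewrite big_nil.
split.
  apply: (eq_integrable mD _ _ _ (integrableD mD (ig i) IHi)) => t _ /=.
  by rewrite big_cons EFinD.
under eq_Rintegral do rewrite big_cons.
by rewrite RintegralD // IHe big_cons.
Qed.

Lemma integral_complex_comb (I : finType) (D : set T) (c : I -> R[i])
    (g : I -> T -> R) :
    measurable D -> (forall i, mu.-integrable D (EFin \o g i)) ->
  (\int[mu]_(t in D) complex.Re (\sum_i c i * (g i t)%:C))
    +i* (\int[mu]_(t in D) complex.Im (\sum_i c i * (g i t)%:C)) =
  \sum_i c i * (\int[mu]_(t in D) g i t)%:C.
Proof.
move=> mD ig.
have sumE (h : I -> R) : \sum_i c i * (h i)%:C =
    (\sum_i complex.Re (c i) * h i) +i* (\sum_i complex.Im (c i) * h i).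
  elim/big_rec3: _ => // i x y z _ ->.
  by case: (c i) => u v; apply/eqP; rewrite eq_complex /= !(mulr0, subr0, add0r) !eqxx.
have iZ (e : I -> R) i : mu.-integrable D (EFin \o (fun t => e i * g i t)).
  by apply: (eq_integrable mD _ _ _ (integrableZl mD (e i) (ig i))) => t _ /=; rewrite EFinM.
have RE (e : I -> R) : \int[mu]_(t in D) (\sum_i e i * g i t) =
    \sum_i e i * \int[mu]_(t in D) g i t.
  rewrite (Rintegral_sum _ mD (iZ e)).2.
  by apply: eq_bigr => i _; rewrite RintegralZl.
under [X in X +i* _]eq_Rintegral do rewrite sumE /=.
under [X in _ +i* X]eq_Rintegral do rewrite sumE /=.
by rewrite !RE sumE.
Qed.

End ComplexCombinations.

Section MatrixIntegral.
Local Open Scope complex_scope.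
Context {R : realType}.
Notation mu := (@lebesgue_measure R).

(** Each entry of the product is a fixed complex combination of the real functions [g i j], so the
    constant outer factors leave the integral. *)
Lemma mx_integral_sandwich n (s e : R) (D := `[s, e]%classic) (P Q Y : 'M[R[i]]_n)
    (g : 'I_n -> 'I_n -> R -> R) :
    (forall i j, mu.-integrable D (EFin \o g i j)) ->
  mx_integral D (fun t => P *m (\matrix_(i, j) ((g i j t)%:C * Y i j)) *m Q) =
  P *m (\matrix_(i, j) ((\int[mu]_(t in D) g i j t)%:C * Y i j)) *m Q.
Proof.
move=> ig; apply/matrixP => k l; rewrite mxE.
have entry (h : 'I_n -> 'I_n -> R) :
    (P *m (\matrix_(i, j) ((h i j)%:C * Y i j)) *m Q) k l =
    \sum_(p : 'I_n * 'I_n) (P k p.1 * Y p.1 p.2 * Q p.2 l) * (h p.1 p.2)%:C.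
  rewrite -(pair_bigA _ (fun i j => P k i * Y i j * Q j l * (h i j)%:C)) /=.
  rewrite exchange_big mxE; apply: eq_bigr => j _; rewrite mxE mulr_suml.
  by apply: eq_bigr => i _; rewrite mxE; ring.
rewrite entry -integral_complex_comb //; last exact: measurable_itv.
by congr (_ +i* _); apply: eq_Rintegral => t _; rewrite entry.
Qed.

End MatrixIntegral.

(** * Spectral form of the powers and conclusion *)

Lemma mul_diag_sandwich (K : comNzRingType) n (P' P X Q' Q : 'M[K]_n)
    (d e : 'rV[K]_n) :
  P' *m diag_mx d *m P *m X *m (Q' *m diag_mx e *m Q) =
  P' *m (\matrix_(i, j) (d 0 i * e 0 j * (P *m X *m Q') i j)) *m Q.
Proof.
set Y := P *m X *m Q'.
transitivity (P' *m (diag_mx d *m Y *m diag_mx e) *m Q).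
  by rewrite /Y !mulmxA.
congr (_ *m _ *m _); move: Y => Y; apply/matrixP => i j.
by rewrite mul_mx_diag mxE mul_diag_mx !mxE; ring.
Qed.

Section SpectralForm.
Local Open Scope complex_scope.
Context {R : realType} {n : nat}.
Implicit Types A B X : 'M[R[i]]_n.

Let eig A i := complex.Re (spectral_diag A 0 i).

(** The outer factors and the inner matrix do not depend on the exponents, so the integrand and both
    boundary terms share one sandwich. *)
Lemma mxpowR_sandwich A B X (u v : R) :
  mxpowR A u *m X *m mxpowR B v =
  invmx (spectralmx A) *m
  (\matrix_(i, j) ((eig A i `^ u * eig B j `^ v)%:C *
     (spectralmx A *m X *m invmx (spectralmx B)) i j)) *m spectralmx B.
Proof.
rewrite /mxpowR /spectral_fun /eig.
move: (invmx (spectralmx A)) (spectralmx A) (spectral_diag A) => P' P p.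
move: (invmx (spectralmx B)) (spectralmx B) (spectral_diag B) => Q' Q q.
rewrite mul_diag_sandwich; congr (_ *m _ *m _).
apply/matrixP => i j; rewrite [LHS]mxE [RHS]mxE; congr (_ * _).
by rewrite !mxE rmorphM.
Qed.

Lemma uinorm_spectral (N : 'M[R[i]]_n -> R) A B X :
  unitarily_invariant_norm N ->
  N (invmx (spectralmx A) *m X *m spectralmx B) = N X.
Proof.
move=> hN; apply: (uinormU hN); last exact: spectral_unitarymx.
by rewrite invmx_unitary ?spectral_unitarymx // trmxC_unitary spectral_unitarymx.
Qed.

Lemma uinorm_mx_integral_le (N : 'M[R[i]]_n -> R) (P Q Y : 'M[R[i]]_n)
    (a b : 'I_n -> R) (F : R -> R -> 'M[R[i]]_n) (s : R) :
    unitarily_invariant_norm N -> (forall Z, N (P *m Z *m Q) = N Z) ->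
    (forall u v, F u v =
       P *m (\matrix_(i, j) ((a i `^ u * b j `^ v)%:C * Y i j)) *m Q) ->
    0 <= s -> s < 1 / 2 ->
  N (mx_integral `[s, 1 - s]%classic (fun v => F v (1 - v)))
  <= (1 - 2 * s) / 2 * N (F (1 - s) s + F s (1 - s)).
Proof.
move=> hN NE FE s0 s1.
have -> : (fun v => F v (1 - v)) = fun v =>
    P *m (\matrix_(i, j) ((a i `^ v * b j `^ (1 - v))%:C * Y i j)) *m Q.
  by apply/funext => v.
rewrite mx_integral_sandwich; last first.
  by move=> i j; apply: powR_kernel_integrable => //; lra.
rewrite NE !FE -mulmxDl -mulmxDr NE.
have := uinorm_powR_integral_le hN a b Y s0 s1; congr (_ <= _ * N _).
apply/matrixP => i j; rewrite [LHS]mxE [RHS]mxE.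
rewrite [X in _ = X + _]mxE [X in _ = _ + X]mxE -mulrDl -rmorphD.
by rewrite [X in _ = X%:C * _]addrC.
Qed.

End SpectralForm.

Theorem theorem2p4 (R : realType) (n : nat) (A B X : 'M[R[i]]_n)
    (hA : psdmx A) (hB : psdmx B) (s : R) (hs0 : 0 <= s) (hs : s < 1 / 2)
    (N : 'M[R[i]]_n -> R) (hN : unitarily_invariant_norm N) :
  N (mx_integral `[s, 1 - s]%classic
       (fun v => mxpowR A v *m X *m mxpowR B (1 - v)))
  <= (1 - 2 * s) / 2 *
     N (mxpowR A (1 - s) *m X *m mxpowR B s
        + mxpowR A s *m X *m mxpowR B (1 - s)).
Proof.
apply: (uinorm_mx_integral_le (F := fun u v => mxpowR A u *m X *m mxpowR B v)
  hN _ _ hs0 hs); last by move=> u v; exact: mxpowR_sandwich.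
by move=> Z; exact: uinorm_spectral.
Qed.
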